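(* There exists a function $f:\mathbb{N}\times\mathbb{N}\to\mathbb{N}$ such that for every finite field $\mathbb{F}$, every $d\in\mathbb{N}$, and every $\mathbb{F}$-representable matroid $M$ with $\mathrm{cd}(M)=d$ and $\mathrm{cd}(M\setminus S)<d$ for every non-empty set $S$ of elements of $M$, we have $|M|\le f(|\mathbb{F}|,d)$.
   Context: $|M|$ is the number of elements of $M$; $M\setminus S$ is deletion (restriction to the complement of $S$) and $M/e$ is the usual matroid contraction. A matroid is connected if any two elements lie in a common circuit; components are maximal connected restrictions. The contraction-depth is defined recursively: if $M$ has a single element, $\mathrm{cd}(M)=1$; if $M$ is not connected, $\mathrm{cd}(M)$ is the maximum contraction-depth of a component of $M$; if $M$ is connected, $\mathrm{cd}(M)=1+\min_{e\in M}\mathrm{cd}(M/e)$. *)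

(* Defs.v *)
From HB Require Import structures.
From mathcomp Require Import all_boot all_order all_algebra all_field.
Set Implicit Arguments. Unset Strict Implicit. Unset Printing Implicit Defensive.
Import GRing.Theory.

(* A matroid on a finite ground set E (a subset of a finite type T),
   given by its rank function (only its values on subsets of E matter). *)
Record matroid (T : finType) := Matroid {
  ground : {set T};
  rk : {set T} -> nat }.

Section MatroidDefs.
Variable T : finType.
Implicit Types (M : matroid T) (X C S : {set T}) (e f : T).

(* F-representability: there are vectors v x in F^r such that the rank of
   every subset X of the ground set is the dimension of the span of
   {v x : x in X}. (This forces the matroid axioms.) *)
Definition representable (F : fieldType) M : Prop :=
  exists (r : nat) (v : T -> 'rV[F]_r),
    forall X, X \subset ground M -> rk M X = \rank (\sum_(x in X) <<v x>>)%MS.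

Definition dependent M X := rk M X < #|X|.

Definition circuit M C : bool :=
  [&& C \subset ground M, dependent M C &
      [forall D : {set T}, (D \proper C) ==> ~~ dependent M D]].

Definition linked M e f : bool :=
  (e == f) || [exists C : {set T}, [&& circuit M C, e \in C & f \in C]].

Definition connected M : bool :=
  [forall e in ground M, forall f in ground M, linked M e f].

Definition component M e : {set T} := [set f in ground M | linked M e f].

Definition restrict M X : matroid T := Matroid (ground M :&: X) (rk M).

Definition delete M S : matroid T := Matroid (ground M :\: S) (rk M).

Definition contract M e : matroid T :=
  Matroid (ground M :\ e) (fun X => rk M (e |: X) - rk M [set e]).

(* contraction-depth, by recursion on a fuel bounding |M|.
   Convention: the empty matroid has contraction-depth 0. *)
Fixpoint cd_aux (n : nat) M : nat :=
  match n with
  | 0 => 0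
  | n'.+1 =>
    if #|ground M| == 0 then 0 else
    if #|ground M| == 1 then 1 else
    if connected M then
      (\big[minn/n'.+1]_(e in ground M) cd_aux n' (contract M e)).+1
    else \max_(e in ground M) cd_aux n' (restrict M (component M e))
  end.

Definition cd M : nat := cd_aux #|ground M| M.

End MatroidDefs.

(* Main.v *)
Require Import Defs.
From HB Require Import structures.
From mathcomp Require Import all_boot all_order all_algebra all_field.
From mathcomp Require Import boolp.
Set Implicit Arguments. Unset Strict Implicit. Unset Printing Implicit Defensive.
Import GRing.Theory.

(* The matroids in question form an antichain: if M and N are both critical of
   contraction-depth d and M is isomorphic to a restriction of N, that
   restriction is N itself. So it suffices that F-representable matroids of
   contraction-depth at most d, with elements labelled from a finite set, are
   well-quasi-ordered by linear embeddings. Induct on d: a represented matroid is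
   the direct sum of its components, so by Higman's lemma the components may be
   considered separately; in a component contract an element e realising the
   minimum, i.e. replace v_x by v_x - t_x v_e, and record the coefficient t_x as
   an additional label of x. *)

(** * Well-quasi-orders and Higman's lemma *)

(** The induction runs over vector families rather than matroids, because the recorded coefficients
    belong to a representation. Embeddings accordingly preserve linear relations in both directions,
    which already determines all ranks. The labels suffice to undo a contraction: a combination with
    coefficients c_x vanishes exactly when the sum of the c_x t_x is zero and the same combination
    of the contracted vectors vanishes, and the first condition reads labels only. The label set
    grows at every level, and stays finite because the field is finite. The bound is obtained by
    contradiction, for one field at a time; dependence on the cardinality alone comes from a maximum
    over the finitely many operation tables of that size. *)

Section WellQuasiOrder.
Variables (X : Type).
Implicit Types (P : X -> Prop) (R : X -> X -> Prop) (s : nat -> X).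

Definition wqo P R :=
  forall s, (forall i, P (s i)) -> exists i j, i < j /\ R (s i) (s j).

Lemma infinite_subsequence (p : nat -> Prop) :
  (forall n, exists m, n <= m /\ p m) ->
  exists g : nat -> nat, (forall i, g i < g i.+1) /\ forall i, p (g i).
Proof.
move=> /choice[f Hf].
exists (fix g i := if i is i'.+1 then f (g i').+1 else f 0).
split=> [i|[|i]]; first by case: (Hf ((fix g i := if i is i'.+1 then f (g i').+1 else f 0) i).+1).
  by case: (Hf 0).
by case: (Hf ((fix g i := if i is i'.+1 then f (g i').+1 else f 0) i).+1).
Qed.

Lemma increasing_ltn (g : nat -> nat) :
  (forall i, g i < g i.+1) -> forall i j, i < j -> g i < g j.
Proof. by move=> /(homo_ltn ltn_trans) gM i j /gM. Qed.

(** Some label recurs infinitely often along the sequence, and [wqo] is applied to the subsequence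
    that carries it. *)
Lemma wqo_label (K : finType) P R (f : X -> K) :
  wqo P R -> wqo P (fun x y => f x = f y /\ R x y).
Proof.
move=> wR s sP.
have [k Hk] : exists k, forall n, exists m, n <= m /\ f (s m) = k.
  apply: contrapT => /forallNP H.
  have {H}/choice[N HN] k : exists n, forall m, n <= m -> f (s m) <> k.
    have /existsNP[n /forallNP Hn] := H k.
    by exists n => m nm fk; apply: (Hn m).
  pose m := \max_k N k.
  exact: (HN (f (s m)) m (leq_bigmax _)).
have [g [gM gk]] := infinite_subsequence Hk.
have [i [j [ij Rij]]] := wR (s \o g) (fun i => sP (g i)).
exists (g i), (g j); split; first exact: increasing_ltn.
by split=> //; rewrite !gk.
Qed.

(** Only finitely many terms lack an [R]-larger later term, since infinitely many of them would form
    a subsequence contradicting [wqo]. Past these, each index has a successor, and iterating the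
    choice gives the chain. *)
Lemma wqo_chain P R s :
  (forall x y z, R x y -> R y z -> R x z) -> wqo P R -> (forall i, P (s i)) ->
  exists g : nat -> nat, (forall i, g i < g i.+1) /\
    forall i j, i < j -> R (s (g i)) (s (g j)).
Proof.
move=> Rtr wR sP.
have [N HN] : exists N, forall i, exists j, N <= i -> i < j /\ R (s i) (s j).
  apply: contrapT => /forallNP H.
  have [|g [gM gT]] :=
      @infinite_subsequence (fun i => forall j, i < j -> ~ R (s i) (s j)).
    move=> n; have /existsNP[m /forallNP Hm] := H n.
    exists m; split=> [|j mj Rmj]; last by apply: (Hm j).
    by rewrite leqNgt; apply/negP => mn; apply: (Hm 0); rewrite leqNgt mn.
  have [i [j [ij Rij]]] := wR (s \o g) (fun i => sP (g i)).
  exact: (gT i (g j) (increasing_ltn gM ij)).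
have {HN}[f Hf] := choice HN.
pose g := fix g i := if i is i'.+1 then f (g i') else N.
have gN i : N <= g i.
  by elim: i => //= i IH; have [/ltnW + _] := Hf _ IH; apply: leq_trans.
exists g; split=> [i|]; first by have [] := Hf _ (gN i).
apply: (@homo_ltn _ (s \o g) R) => [y x z|i] /=; first exact: Rtr.
by have [] := Hf _ (gN i).
Qed.

End WellQuasiOrder.

Lemma wqo_preim X Y (f : Y -> X) (P : X -> Prop) (R : X -> X -> Prop) :
  wqo P R -> wqo (fun y => P (f y)) (fun y z => R (f y) (f z)).
Proof. by move=> wR s; apply: (wR (f \o s)). Qed.

Section Higman.
Variables (X : Type) (P : X -> Prop) (R : X -> X -> Prop).
Implicit Types (w : seq X) (s t : nat -> seq X).

Fixpoint all_prop w := if w is x :: w' then P x /\ all_prop w' else True.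

Lemma all_prop_map (K : eqType) (f : K -> X) (ks : seq K) :
  {in ks, forall k, P (f k)} -> all_prop (map f ks).
Proof.
elim: ks => //= k ks IH H; split; first by apply: H; rewrite mem_head.
by apply: IH => i ik; apply: H; rewrite inE ik orbT.
Qed.

Inductive word_emb : seq X -> seq X -> Prop :=
| WordEmbNil w : word_emb [::] w
| WordEmbSkip w y w' : word_emb w w' -> word_emb w (y :: w')
| WordEmbCons x w y w' : R x y -> word_emb w w' -> word_emb (x :: w) (y :: w').

Definition bad s :=
  (forall i, all_prop (s i)) /\ forall i j, i < j -> ~ word_emb (s i) (s j).

Lemma bad_min_at s n : bad s -> exists s',
  [/\ bad s', forall i, i < n -> s' i = s i &
      forall t, bad t -> (forall i, i < n -> t i = s i) ->
        size (s' n) <= size (t n)].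
Proof.
move=> bs.
pose q k := `[< exists t, [/\ bad t, forall i, i < n -> t i = s i & size (t n) = k] >].
have exq : exists k, q k by exists (size (s n)); apply/asboolP; exists s.
case: (ex_minnP exq) => k /asboolP[s' [bs' s's <-]] kmin.
by exists s'; split=> // t bt ts; apply: kmin; apply/asboolP; exists t.
Qed.

(* Nash-Williams: fix the n-th word of least length among the bad sequences that
   agree with the words already fixed. *)
Lemma minimal_bad s : bad s -> exists m, bad m /\
  forall n t, bad t -> (forall i, i < n -> t i = m i) -> size (m n) <= size (t n).
Proof.
move=> bs.
have /choice[step Hstep] (sn : (nat -> seq X) * nat) : exists s', bad sn.1 ->
    [/\ bad s', forall i, i < sn.2 -> s' i = sn.1 i &
      forall t, bad t -> (forall i, i < sn.2 -> t i = sn.1 i) ->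
        size (s' sn.2) <= size (t sn.2)].
  have [/bad_min_at H|nb] := pselect (bad sn.1); last by exists sn.1.
  by have [s' Hs'] := H sn.2; exists s'.
pose S := fix S n := if n is n'.+1 then step (S n', n') else s.
have bS n : bad (S n) by elim: n => //= n IH; have [] := Hstep (S n, n) IH.
have Seq n i : i < n -> S n.+1 i = S n i.
  by have [_ + _] := Hstep (S n, n) (bS n); apply.
have Sm n i : i < n -> S n i = S i.+1 i.
  elim: n => // n IH; rewrite ltnS leq_eqVlt => /predU1P[->//|lin].
  by rewrite Seq // IH.
(* The diagonal agrees with the bad sequence [S j.+1] on all indices up to [j], so it inherits
   badness pair by pair. *)
exists (fun n => S n.+1 n); split; first split.
- by move=> i; have [] := bS i.+1.
- move=> i j ij; rewrite -(Sm j.+1 i); last by rewrite ltnS ltnW.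
  by have [_] := bS j.+1; apply.
- move=> n t bt tm; have [_ _] := Hstep (S n, n) (bS n); apply=> // i lin /=.
  by rewrite tm // Sm.
Qed.

(** In a minimal bad sequence no word is empty. Along a subsequence whose first letters form a
    chain, the first letters are removed; putting these tails after the first [g 0] words gives a
    bad sequence with a shorter word at [g 0]. *)
Lemma higman : (forall x y z, R x y -> R y z -> R x z) ->
  wqo P R -> wqo all_prop word_emb.
Proof.
move=> Rtr wR s0 s0P; apply: contrapT => Hs0.
have [|m [[mP mbad] mmin]] := @minimal_bad s0.
  by split=> // i j ij Rij; apply: Hs0; exists i, j.
have /choice[xu Hxu] i : exists xu, m i = xu.1 :: xu.2.
  case E: (m i) => [|a u]; last by exists (a, u).
  by case: (mbad i i.+1) => //; rewrite E; constructor.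
pose x i := (xu i).1; pose u i := (xu i).2.
have Hm i : m i = x i :: u i by rewrite Hxu.
have [|g [gM gR]] := wqo_chain (s := x) Rtr wR.
  by move=> i; have := mP i; rewrite Hm => -[].
pose t i := if i < g 0 then m i else u (g (i - g 0)).
have bt : bad t.
  split=> [i|i j ij]; rewrite /t.
    by case: ifP => // _; have := mP (g (i - g 0)); rewrite Hm => -[].
  have gmono k : g 0 <= g k.
    by case: k => // k; apply: ltnW; apply: increasing_ltn.
  case: (ltnP i (g 0)) => [ig|gi]; case: (ltnP j (g 0)) => [jg|gj] H.
  - exact: mbad ij H.
  - apply: (mbad i (g (j - g 0))); first exact: leq_trans ig (gmono _).
    by rewrite (Hm (g _)); constructor.
  - by have := leq_ltn_trans gi (ltn_trans ij jg); rewrite ltnn.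
  - have lt : i - g 0 < j - g 0 by rewrite ltn_sub2r // (leq_ltn_trans gi).
    apply: (mbad (g (i - g 0)) (g (j - g 0))); first exact: increasing_ltn.
    by rewrite !Hm; constructor=> //; apply: gR.
have : size (m (g 0)) <= size (t (g 0)) by apply: mmin => // i ig; rewrite /t ig.
by rewrite /t ltnn subnn Hm /= ltnn.
Qed.

(** The embedding uses each position of [ks'] at most once, and [uniq] turns distinct positions into
    distinct keys; [k0] is a filler value. *)
Lemma word_emb_map (K K' : eqType) (k0 : K') (f : K -> X) (g : K' -> X) ks ks' :
  uniq ks' -> word_emb (map f ks) (map g ks') -> exists sg : K -> K',
  {in ks &, injective sg} /\ {in ks, forall k, sg k \in ks' /\ R (f k) (g (sg k))}.
Proof.
move Ew: (map f ks) => w; move Ew': (map g ks') => w' + H.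
elim: H ks ks' Ew Ew' => {w w'}[w|w y w' _ IH|x w y w' Rxy _ IH] [|k ks] [|k' ks'] //=.
- by move=> *; exists (fun=> k0).
- by move=> *; exists (fun=> k0).
- by move=> *; exists (fun=> k0).
- move=> Ew [Ey Ew'] /andP[k'N un]; have [sg [sgI sgR]] := IH (k :: ks) ks' Ew Ew' un.
  exists sg; split=> // i ik; have [] := sgR i ik.
  by split=> //; rewrite inE; apply/orP; right.
- move=> [Ex Ew] [Ey Ew'] /andP[k'N un]; have [sg [sgI sgR]] := IH ks ks' Ew Ew' un.
  exists (fun i => if i == k then k' else sg i); split=> [i j|i].
    rewrite !inE; case: eqVneq => [->|ik] /=; case: eqVneq => [->|jk] //=.
    + by move=> _ /sgR[+ _] E; rewrite -E (negPf k'N).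
    + by move=> /sgR[+ _] _ E; rewrite E (negPf k'N).
    + exact: sgI.
  rewrite !inE; case: eqVneq => [->|ik] /=; first by rewrite eqxx -Ex -Ey in Rxy *.
  by move=> /sgR[-> ?]; rewrite orbT.
Qed.

End Higman.

(* [minn] has no unit in [nat], so the monoid lemmas for big operators do not apply. *)
Lemma bigminn_ltn (I : finType) (P : pred I) (G : I -> nat) n d :
  \big[minn/n]_(e | P e) G e < d <-> n < d \/ exists2 e, P e & G e < d.
Proof.
split=> [H|].
  have [/existsP[e /andP[Pe Ge]]|/existsPn N] := boolP [exists e, P e && (G e < d)].
    by right; exists e.
  left; rewrite ltnNge; apply: contraL H => dn; rewrite -leqNgt.
  elim/big_rec: _ => // e m Pe dm; rewrite leq_min dm andbT leqNgt.
  by have := N e; rewrite Pe.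
case=> [nd|[e Pe Ge]].
  by elim/big_rec: _ => // e m _ md; rewrite gtn_min md orbT.
apply: leq_ltn_trans Ge; have : e \in index_enum I by apply: mem_index_enum.
elim: (index_enum I) => // i s IH; rewrite inE big_cons => /predU1P[<-|/IH le].
  by rewrite Pe geq_minl.
by case: ifP => // _; apply: leq_trans (geq_minr _ _) le.
Qed.

Lemma bigminn_imset (I J : finType) (h : I -> J) (A : {set I}) (G : J -> nat) n :
  \big[minn/n]_(j in h @: A) G j = \big[minn/n]_(i in A) G (h i).
Proof.
have eq_lt a b : (forall d, a < d <-> b < d) -> a = b.
  move=> ab; apply/eqP; rewrite eqn_leq.
  by rewrite -(ltnS a) -(ltnS b); apply/andP; split; apply/ab; rewrite ltnS.
apply: eq_lt => d; rewrite !bigminn_ltn; split=> -[|[i]]; try by left.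
  by case/imsetP => j jA -> Gj; right; exists j.
by move=> iA Gi; right; exists (h i) => //; apply: imset_f.
Qed.

Local Open Scope ring_scope.

(** * Labelled vector families *)

Definition comb (F : fieldType) (T : finType) r (v : T -> 'rV[F]_r) (c : T -> F)
  (A : {set T}) := \sum_(x in A) c x *: v x.

Section Combination.
Variables (F : fieldType) (T : finType) (r : nat).
Implicit Types (v : T -> 'rV[F]_r) (c : T -> F) (A B : {set T}).

Lemma comb_mulmx s v c A (M : 'M[F]_(r, s)) :
  \sum_(x in A) c x *: (v x *m M) = comb v c A *m M.
Proof. by rewrite mulmx_suml; apply: eq_bigr => x _; rewrite scalemxAl. Qed.

Lemma comb_partition (K : finType) (p : T -> K) v c A :
  comb v c A = \sum_(k in p @: A) comb v c [set x in A | p x == k].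
Proof.
rewrite /comb (partition_big p (mem (p @: A))) => [|x xA]; last exact: imset_f.
by apply: eq_bigr => k _; apply: eq_bigl => x; rewrite inE.
Qed.

(** Transports coefficients along [phi] by summing over fibres, so that hypotheses about relations
    of the target family apply to relations of the source. *)
Lemma comb_push (T' : finType) (phi : T' -> T) v (c : T' -> F) (A : {set T'}) B :
  comb v (fun b => \sum_(a in A | phi a == b) c a) B =
  comb (v \o phi) c [set a in A | phi a \in B].
Proof.
rewrite /comb [RHS](partition_big phi (mem B)) => [|a]; last by rewrite inE => /andP[].
apply: eq_bigr => b bB; rewrite scaler_suml; apply: eq_big => [a|a /andP[_ /eqP<-]//].
rewrite inE -andbA; congr andb.
by apply/eqP/andP => [->|[_ /eqP//]]; rewrite eqxx.
Qed.

(* [P] projects along [v e]; when [v e] is nonzero, [v e *m P = 0] says that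
   [v e *m h = 1], so that [v x *m P = v x - (v x *m h) *: v e] represents the
   contraction of [e]. A loop [e] is allowed with [h = 0]. *)
Definition rooted (D : (T -> 'rV[F]_r) -> {set T} -> Prop) v A :=
  exists e (h : 'cV[F]_r), let P := 1%:M - h *m v e in
  [/\ e \in A, v e *m P = 0 & D (fun x => v x *m P) (A :\ e)].

(** The spans of the fibres of [p] form a direct sum, expressed through relations. Keys are sets so
    that a component can serve as its own key. *)
Definition separates (p : T -> {set T}) v A := forall c, comb v c A = 0 ->
  forall k, comb v c [set x in A | p x == k] = 0.

(** Stands in for contraction-depth at most [d] while keeping the vectors: each level splits into a
    direct sum and contracts one element in every summand. *)
Fixpoint shallow d v A : Prop :=
  if d is d'.+1 then exists p, separates p v A /\
    forall k, k \in p @: A -> rooted (shallow d') v [set x in A | p x == k]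
  else A = set0.

End Combination.

(** [point] supplies default values for maps into [carrier], even when [dom] is empty. *)
Record vfamily (F : fieldType) (Q : Type) := VFamily {
  dim : nat;
  carrier : finType;
  point : carrier;
  vec : carrier -> 'rV[F]_dim;
  dom : {set carrier};
  lab : carrier -> Q }.

Section Embedding.
Variables (F : fieldType) (Q : Type).
Implicit Types (x y z : vfamily F Q).

Definition emb_by x y (phi : carrier x -> carrier y) :=
  [/\ {in dom x &, injective phi},
      {in dom x, forall a, phi a \in dom y /\ lab (phi a) = lab a} &
      forall c, comb (@vec _ _ x) c (dom x) = 0 <->
        comb (@vec _ _ y \o phi) c (dom x) = 0].

Definition emb x y := exists phi, @emb_by x y phi.

Lemma emb_trans x y z : emb x y -> emb y z -> emb x z.
Proof.
move=> [phi [phiI phiD phiR]] [psi [psiI psiD psiR]].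
exists (psi \o phi); split=> [a b aD bD /= E|a aD|c].
- by apply: phiI => //; apply: psiI => //; case: (phiD _ aD); case: (phiD _ bD).
- by have [/psiD[? ->] <-] := phiD _ aD.
- rewrite phiR; have S : [set a in dom x | phi a \in dom y] = dom x.
    by apply/setP => a; rewrite inE andb_idr // => /phiD[].
  have := psiR (fun b => \sum_(a in dom x | phi a == b) c a).
  by rewrite !comb_push S.
Qed.

Definition part x k p :=
  VFamily (point x) (@vec _ _ x) [set a in dom x | p a == k :> {set carrier x}] (@lab _ _ x).

Definition decomposes x (w : seq (vfamily F Q)) := exists p : carrier x -> {set carrier x},
  separates p (@vec _ _ x) (dom x) /\
  w = [seq part k p | k <- enum (p @: dom x)].

(** The embeddings of the parts are glued. Different parts land in different parts because [sg] is
    injective, and on both sides a relation holds exactly when it holds on each part. *)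
Lemma decomposes_emb x y w w' :
  decomposes x w -> decomposes y w' -> word_emb emb w w' -> emb x y.
Proof.
move=> [p [pS ->]] [q [qS ->]] /(word_emb_map set0 (enum_uniq _))[sg [sgI sgR]].
have {sgR} sgP k : k \in p @: dom x -> emb (part k p) (part (sg k) q).
  by rewrite -mem_enum => /sgR[].
have /choice[Phi HPhi] k : exists phi : carrier x -> carrier y,
    k \in p @: dom x -> @emb_by (part k p) (part (sg k) q) phi.
  have [/sgP[phi Hphi]|_] := boolP (k \in p @: dom x); first by exists phi.
  by exists (fun=> point y).
pose phi a := Phi (p a) a.
have HP a : a \in dom x -> @emb_by (part (p a) p) (part (sg (p a)) q) (Phi (p a)).
  by move=> aD; apply: HPhi; apply: imset_f.
have phiD a : a \in dom x -> [/\ phi a \in dom y, q (phi a) = sg (p a) & lab (phi a) = lab a].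
  move=> aD; have [_ /(_ a)+ _] := HP a aD.
  by rewrite !inE aD eqxx /= => -[] // /andP[? /eqP ?].
have Ephi c k : comb (@vec _ _ y \o phi) c [set a in dom x | p a == k] =
    comb (@vec _ _ y \o Phi k) c [set a in dom x | p a == k].
  by apply: eq_bigr => a; rewrite inE /phi /= => /andP[_ /eqP->].
exists phi; split=> [a b aD bD E|a aD|c].
- have Ep : p a = p b.
    apply: sgI; rewrite ?mem_enum ?imset_f //.
    by have [_ <- _] := phiD a aD; have [_ <- _] := phiD b bD; rewrite E.
  have [+ _ _] := HP b bD; apply; rewrite ?inE ?aD ?bD ?Ep ?eqxx //.
  by move: E; rewrite /phi Ep.
- by have [? _ ?] := phiD a aD.
- split=> H.
    rewrite (comb_partition p) big1 // => k kp; rewrite Ephi.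
    by have [_ _ R] := HPhi k kp; apply/R; apply: pS.
  rewrite (comb_partition p) big1 // => k kp.
  have [_ _ R] := HPhi k kp; apply/R; rewrite /= -Ephi.
  (* The relation is pushed into [y], split there by [q], and pulled back: the fibre of [q] over
     [sg k] meets the image exactly in the image of part [k]. *)
  have := qS (fun b => \sum_(a in dom x | phi a == b) c a); rewrite comb_push.
  have -> : [set a in dom x | phi a \in dom y] = dom x.
    by apply/setP => a; rewrite inE andb_idr // => /phiD[].
  move=> /(_ H (sg k)); rewrite comb_push; congr (comb _ _ _ = 0).
  apply/setP => a; rewrite !inE; apply: andb_id2l => aD.
  have [-> -> _] := phiD a aD; apply/eqP/eqP => [|->//].
  by apply: sgI; rewrite mem_enum // imset_f.
Qed.

(** The extended label of the removed root has no place in [y] and is kept separately as [l]. *)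
Definition reduces x (y : vfamily F (Q * F)) (l : Q * F) :=
  exists e (h : 'cV[F]_(dim x)),
  let P := 1%:M - h *m vec e in
  let val a := (lab a, (vec a *m h) 0 0) in
  [/\ e \in dom x, vec e *m P = 0, l = val e &
      y = VFamily (point x) (fun a => vec a *m P) (dom x :\ e) val].

End Embedding.

(** With w the combination, w P = w - (w h) v_e, so w is zero exactly when w h and w P are; the term
    of [f] drops out of w P. The map [phi] allows use both on a family and on its image under an
    embedding. *)
Lemma comb_root (F : fieldType) (T S : finType) r (v : T -> 'rV[F]_r) (e : T)
    (h : 'cV[F]_r) (phi : S -> T) c (A : {set S}) (f : S) :
  let P := 1%:M - h *m v e in
  f \in A -> phi f = e -> v e *m P = 0 ->
  comb (v \o phi) c A = 0 <->
    \sum_(a in A) c a * (v (phi a) *m h) 0 0 = 0 /\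
    comb ((fun x => v x *m P) \o phi) c (A :\ f) = 0.
Proof.
move=> P fA fe veP.
have -> : comb ((fun x => v x *m P) \o phi) c (A :\ f) = comb (v \o phi) c A *m P.
  rewrite -comb_mulmx [RHS](big_setD1 f) //= fe veP scaler0 add0r.
  by apply: eq_bigr.
have -> : \sum_(a in A) c a * (v (phi a) *m h) 0 0 = (comb (v \o phi) c A *m h) 0 0.
  by rewrite -comb_mulmx summxE; apply: eq_bigr => a _; rewrite [RHS]mxE.
split=> [->|[h0]]; first by rewrite !mul0mx mxE.
by rewrite mulmxBr mulmx1 mulmxA [_ *m h]mx11_scalar h0 mul_scalar_mx scale0r subr0.
Qed.

(** The map is extended by sending root to root. Equal labels make the scalar conditions of
    [comb_root] on the two sides the same equation. *)
Lemma reduces_emb (F : fieldType) Q (x x' : vfamily F Q) y y' l :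
  reduces x y l -> reduces x' y' l -> emb y y' -> emb x x'.
Proof.
move=> [e [h [eD eP lE ->]]] [e' [h' [eD' eP' lE' ->]]] [].
rewrite /emb_by /= => phi [phiI phiD phiR].
pose psi a := if a == e then e' else phi a.
have psie : psi e = e' by rewrite /psi eqxx.
have psiN a : a != e -> psi a = phi a by rewrite /psi => /negPf->.
have phiD' a : a \in dom x -> a != e -> [/\ phi a \in dom x', phi a != e',
    lab (phi a) = lab a & (vec (phi a) *m h') 0 0 = (vec a *m h) 0 0].
  move=> aD ae; have := phiD a; rewrite !inE aD ae => /(_ isT)[/andP[-> ->]].
  by case.
have psiD a : a \in dom x -> [/\ psi a \in dom x',
    lab (psi a) = lab a & (vec (psi a) *m h') 0 0 = (vec a *m h) 0 0].
  move=> aD; have [->|ae] := eqVneq a e; last first.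
    by rewrite psiN //; have [] := phiD' a aD ae.
  by rewrite psie; move: lE'; rewrite lE => -[-> ->].
exists psi; split=> [a b aD bD|a aD|c].
- have [->|ae] := eqVneq a e; have [->|be] := eqVneq b e => //.
  + by rewrite psie psiN // => E; have [_] := phiD' b bD be; rewrite E eqxx.
  + by rewrite psie psiN // => E; have [_] := phiD' a aD ae; rewrite E eqxx.
  + by rewrite !psiN //; apply: phiI; rewrite !inE ?ae ?be.
- by have [] := psiD a aD.
- rewrite (comb_root c eD psie eP').
  rewrite -[@vec _ _ x]/(@vec _ _ x \o id) (@comb_root _ _ _ _ _ e h id c _ e eD erefl eP) /=.
  have -> : \sum_(a in dom x) c a * (vec (psi a) *m h') 0 0 =
      \sum_(a in dom x) c a * (vec a *m h) 0 0.
    by apply: eq_bigr => a aD; have [_ _ ->] := psiD a aD.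
  suff -> : comb ((fun a => vec a *m (1%:M - h' *m vec e')) \o psi) c (dom x :\ e) =
    comb ((fun a => vec a *m (1%:M - h' *m vec e')) \o phi) c (dom x :\ e).
    by split=> -[-> /phiR ?].
  by apply: eq_bigr => a; rewrite !inE => /andP[ae _]; rewrite /= psiN.
Qed.

(** [Q] varies in the induction because contraction replaces it by [Q * F]. Rooted families are
    treated first, and Higman's lemma then assembles them. *)
Lemma wqo_shallow (F : finFieldType) d (Q : finType) :
  wqo (fun x : vfamily F Q => shallow d (@vec _ _ x) (dom x)) (@emb F Q).
Proof.
elim: d Q => [|d IH] Q s sP /=.
  exists 0%N, 1%N; split=> //; exists (fun=> point (s 1%N)).
  have D0 := sP 0%N; rewrite /= in D0.
  by split=> [a b|a|c]; rewrite /comb D0 ?inE // !big_set0.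
have wR : wqo (fun x : vfamily F Q =>
    rooted (shallow d) (@vec _ _ x) (dom x)) (@emb F Q).
  move=> {sP} {}s sP.
  have /choice[yl Hyl] i : exists yl, reduces (s i) yl.1 yl.2 /\
      shallow d (@vec _ _ yl.1) (dom yl.1).
    have [e [h [eD eP Sh]]] := sP i.
    pose val a := (lab a, (vec a *m h) 0 0).
    exists (VFamily (point (s i)) (fun a => vec a *m (1%:M - h *m vec e))
              (dom (s i) :\ e) val, val e).
    by split=> //=; exists e, h.
  have wQ := wqo_label snd (wqo_preim (f := fst) (IH (Q * F)%type)).
  have [i [j [ij [El Ey]]]] := wQ _ yl (fun i => (Hyl i).2).
  exists i, j; split=> //; have [Ri _] := Hyl i; have [Rj _] := Hyl j.
  by apply: reduces_emb Ey; [exact: Ri | rewrite El].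
have /choice[w Hw] i : exists w, decomposes (s i) w /\
    all_prop (fun x : vfamily F Q => rooted (shallow d) (@vec _ _ x) (dom x)) w.
  have [p [pS pR]] := sP i.
  exists [seq part k p | k <- enum (p @: dom (s i))]; split; first by exists p.
  by apply: all_prop_map => k; rewrite mem_enum => /pR.
have [i [j [ij E]]] := higman (@emb_trans F Q) wR (fun i => (Hw i).2).
exists i, j; split=> //.
exact: decomposes_emb (Hw i).1 (Hw j).1 E.
Qed.

(** * Ranks and linear relations *)

Section Span.
Variables (F : fieldType) (T : finType).
Implicit Types (c d : T -> F) (A B X : {set T}).

Definition rowspan r (v : T -> 'rV[F]_r) X := (\sum_(x in X) <<v x>>)%MS.

Lemma span_combP r (v : T -> 'rV[F]_r) (w : 'rV_r) X :
  (w <= rowspan v X)%MS <-> exists c, w = comb v c X.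
Proof.
split=> [/sub_sumsmxP[u ->]|[c ->]].
  have /choice[c Hc] x : exists a, u x *m <<v x>>%MS = a *: v x.
    by apply/sub_rVP; rewrite -(genmxE (v x)) submxMl.
  by exists c; apply: eq_bigr => x _; rewrite Hc.
by apply: summx_sub => x xX; rewrite scalemx_sub // (sumsmx_sup x) // genmxE.
Qed.

Lemma span_relP r (v : T -> 'rV[F]_r) x X : x \notin X ->
  (v x <= rowspan v X)%MS <-> exists c, c x != 0 /\ comb v c (x |: X) = 0.
Proof.
move=> xX; split=> [/span_combP[c Ec]|[c [cx]]].
  exists (fun y => if y == x then - 1 else c y).
  rewrite eqxx oppr_eq0 oner_eq0; split=> //.
  rewrite /comb big_setU1 //= eqxx scaleN1r Ec addrC; apply/eqP; rewrite subr_eq0.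
  apply/eqP/eq_bigr => y yX; case: eqP => // yx; by rewrite -yx yX in xX.
rewrite /comb big_setU1 //= => /eqP; rewrite addr_eq0 => /eqP E.
apply/span_combP; exists (fun y => - (c x)^-1 * c y).
rewrite -[LHS](scalerK cx) E scalerN -scaleNr /comb scaler_sumr.
by apply: eq_bigr => y _; rewrite scalerA.
Qed.

Lemma rank_span_setU1 r (v : T -> 'rV[F]_r) x X : x \notin X ->
  \rank (rowspan v (x |: X)) = (~~ (v x <= rowspan v X)%MS + \rank (rowspan v X))%N.
Proof.
move=> xX; rewrite /rowspan big_setU1 //= -/(rowspan v X).
have [sub|nsub] := boolP (v x <= rowspan v X)%MS.
  by apply: eqmx_rank; apply/eqmxP/addsmx_idPr; rewrite genmxE.
have := mxrank_sum_cap <<v x>>%MS (rowspan v X).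
rewrite genmxE rank_rV; have -> : v x != 0 by apply: contraNneq nsub => ->; apply: sub0mx.
have -> : \rank (<<v x>> :&: rowspan v X)%MS = 0%N; last by rewrite addn0.
apply/eqP; rewrite mxrank_eq0; apply: contraNT nsub => cap0.
have : (<<v x>> :&: rowspan v X <= v x)%MS by rewrite -(genmxE (v x)) capmxSl.
move=> sub; apply: submx_trans (capmxSr <<v x>>%MS _).
have rle : (\rank (v x) <= \rank (<<v x>> :&: rowspan v X)%MS)%N.
  by rewrite rank_rV (leq_trans (leq_b1 _)) // lt0n mxrank_eq0.
by rewrite -(mxrank_leqif_sup sub) eqn_leq rle mxrankS.
Qed.

Lemma comb_mask r (v : T -> 'rV[F]_r) c A X : X \subset A ->
  comb v (fun x => if x \in X then c x else 0) A = comb v c X.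
Proof.
move=> XA; rewrite /comb (big_setID X) /= (setIidPr XA).
rewrite [X in _ + X]big1 ?addr0 => [|x]; last first.
  by rewrite inE => /andP[/negPf-> _]; rewrite scale0r.
by apply: eq_bigr => x ->.
Qed.

Lemma comb_subr r (v : T -> 'rV[F]_r) c d t A :
  comb v (fun x => c x - t * d x) A = comb v c A - t *: comb v d A.
Proof.
rewrite /comb scaler_sumr -sumrB; apply: eq_bigr => x _.
by rewrite scalerBl scalerA.
Qed.

Lemma set_setU1_ind (P : {set T} -> Prop) : P set0 ->
  (forall x X, x \notin X -> P X -> P (x |: X)) -> forall X, P X.
Proof.
move=> P0 PS X; have [n] := ubnP #|X|; elim: n X => // n IH X Xn.
have [->//|[x xX]] := set_0Vmem X.
rewrite -(setD1K xX); apply: PS; first by rewrite setD11.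
by apply: IH; move: Xn; rewrite (cardsD1 x) xX.
Qed.

(** Building [X] one element at a time, each rank increase is decided by the existence of a
    relation. *)
Lemma rank_span_eq r s (v : T -> 'rV[F]_r) (w : T -> 'rV[F]_s) A :
  (forall c, comb v c A = 0 <-> comb w c A = 0) ->
  forall X, X \subset A -> \rank (rowspan v X) = \rank (rowspan w X).
Proof.
move=> vw; apply: set_setU1_ind => [_|x X xX IH xXA].
  by rewrite /rowspan !big_set0 !mxrank0.
have XA : X \subset A by apply: subset_trans xXA; apply: subsetUr.
rewrite !rank_span_setU1 // IH //; congr (~~ _ + _)%N.
apply/idP/idP => /(span_relP _ xX)[c [cx c0]]; apply/(span_relP _ xX);
  exists c; split=> //.
  by rewrite -(comb_mask _ _ xXA); apply/vw; rewrite comb_mask.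
by rewrite -(comb_mask _ _ xXA); apply/vw; rewrite comb_mask.
Qed.

Lemma span_dependentP r (v : T -> 'rV[F]_r) X :
  (\rank (rowspan v X) < #|X|)%N <->
  exists c, comb v c X = 0 /\ exists2 x, x \in X & c x != 0.
Proof.
(* The cardinality bound joins the induction: it gives the strict inequality when the added vector
   already lies in the span. *)
suff : (\rank (rowspan v X) <= #|X|)%N /\ ((\rank (rowspan v X) < #|X|)%N <->
  exists c, comb v c X = 0 /\ exists2 x, x \in X & c x != 0) by case.
elim/set_setU1_ind: X => [|x X xX [le IH]].
  rewrite /rowspan big_set0 mxrank0 cards0; split=> //.
  by split=> // -[c [_ [x]]]; rewrite inE.
rewrite rank_span_setU1 // cardsU1 xX; split.
  by rewrite leq_add // leq_b1.
have [sub|nsub] := boolP (v x <= rowspan v X)%MS; rewrite /= ?add0n ?add1n ?ltnS.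
  split=> // _; have /(span_relP _ xX)[c [cx c0]] := sub.
  by exists c; split=> //; exists x => //; rewrite setU11.
split=> [/IH[c [c0 [y yX cy]]]|[c [c0 [y yX cy]]]].
  exists (fun z => if z \in X then c z else 0); rewrite comb_mask ?subsetUr //.
  by split=> //; exists y; rewrite ?yX // inE yX orbT.
have cx : c x = 0.
  by apply/eqP; apply: contraNT nsub => cx; apply/(span_relP _ xX); exists c.
apply/IH; exists c; move: c0; rewrite /comb big_setU1 //= cx scale0r add0r.
split=> //; exists y => //; move: yX; rewrite !inE => /predU1P[yx|//].
by rewrite yx cx eqxx in cy.
Qed.

Lemma rank_span_contract r (v : T -> 'rV[F]_r) e (h : 'cV[F]_r) X :
  let P := 1%:M - h *m v e in
  v e != 0 -> (v e *m h) 0 0 = 1 -> e \notin X ->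
  \rank (rowspan v (e |: X)) = (\rank (rowspan (fun x => v x *m P) X)).+1.
Proof.
move=> P ve0 veh; have veP : v e *m P = 0.
  by rewrite mulmxBr mulmx1 mulmxA [_ *m h]mx11_scalar veh mul_scalar_mx scale1r subrr.
elim/set_setU1_ind: X => [_|x X xX IH].
  by rewrite /rowspan setU0 big_set1 big_set0 mxrank0 genmxE rank_rV ve0.
rewrite !inE negb_or => /andP[ex eX].
have xeX : x \notin e |: X by rewrite !inE negb_or eq_sym ex.
rewrite setUCA (rank_span_setU1 _ xeX) (rank_span_setU1 _ xX) IH // addnS; congr (~~ _ + _).+1.
have exX : (x |: (e |: X)) :\ e = x |: X.
  by rewrite setUCA setU1K // !inE negb_or ex.
have eexX : e \in x |: (e |: X) by rewrite !inE eqxx orbT.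
have rootE c := @comb_root _ _ _ _ v e h id c _ e eexX erefl veP.
apply/idP/idP.
  move=> /(span_relP _ xeX)[c [cx /(rootE _)[_]]]; rewrite exX => c0.
  by apply/(span_relP _ xX); exists c.
move=> /(span_relP _ xX)[c [cx c0]]; apply/(span_relP _ xeX).
(* The coefficient [- t] at [e] is the one that makes the scalar condition of [comb_root] hold, as
   [v e *m h] is 1. *)
pose t := \sum_(a in x |: X) c a * (v a *m h) 0 0.
pose c' y := if y == e then - t else c y.
have cE y : y \in x |: X -> c' y = c y.
  by rewrite /c'; case: eqP => // ->; rewrite !inE (negPf ex) (negPf eX).
exists c'; rewrite cE ?setU11; split=> //; apply/(rootE _); split.
  rewrite (big_setD1 e eexX) /= exX {1}/c' eqxx veh mulr1 addrC; apply/eqP.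
  by rewrite subr_eq0; apply/eqP/eq_bigr => y /cE->.
by rewrite exX -[RHS]c0; apply: eq_bigr => y /cE->.
Qed.

End Span.

(** * Circuits and components of represented matroids *)

Definition represents (F : fieldType) (T : finType) r (v : T -> 'rV[F]_r)
  (M : matroid T) := forall X : {set T}, X \subset ground M -> rk M X = \rank (rowspan v X).

Section Circuits.
Variables (F : fieldType) (T : finType) (r : nat) (v : T -> 'rV[F]_r).
Variable (M : matroid T).
Hypothesis vM : represents v M.
Local Notation E := (ground M).
Implicit Types (c d : T -> F) (C D X : {set T}).

Definition supp c := [set x in E | c x != 0].

Lemma dependent_comb X : X \subset E ->
  dependent M X <-> exists c, comb v c X = 0 /\ exists2 x, x \in X & c x != 0.
Proof. by move=> XE; rewrite /dependent vM //; apply: span_dependentP. Qed.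

Lemma comb_supp c X : supp c \subset X -> X \subset E -> comb v c X = comb v c E.
Proof.
move=> /subsetP cX XE; rewrite -(comb_mask _ _ XE); apply: eq_bigr => x xE.
case: ifPn => // xX; have -> // : c x = 0.
by apply/eqP; apply: contraNT xX => cx; apply: cX; rewrite inE xE.
Qed.

Lemma dependent_supp c : comb v c E = 0 -> supp c != set0 -> dependent M (supp c).
Proof.
have sE : supp c \subset E by apply/subsetP => x; rewrite inE => /andP[].
move=> c0 /set0Pn[x xc]; apply/(dependent_comb sE).
exists c; rewrite comb_supp //; split=> //; exists x => //.
by move: xc; rewrite inE => /andP[].
Qed.

(** The support of a relation witnessing that [C] is dependent is itself dependent, so minimality
    makes it all of [C]. *)
Lemma circuit_combP C : circuit M C -> exists d, comb v d E = 0 /\ supp d = C.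
Proof.
move=> /and3P[CE /(dependent_comb CE)[c [c0 [x xC cx]]] /forallP Cmin].
pose d y := if y \in C then c y else 0.
have d0 : comb v d E = 0 by rewrite comb_mask.
have dC : supp d \subset C.
  by apply/subsetP => y; rewrite inE /d; case: ifP => //; rewrite eqxx andbF.
have xd : x \in supp d by rewrite inE /d xC cx (subsetP CE).
exists d; split=> //; apply/eqP; have := Cmin (supp d).
rewrite properEneq dC andbT; case: eqP => //= _ /negP[].
by apply: dependent_supp => //; apply/set0Pn; exists x.
Qed.

Lemma dependent_circuit X : X \subset E -> dependent M X ->
  exists2 C, circuit M C & C \subset X.
Proof.
move=> XE /(@minset_exists _ (fun Y => dependent M Y))[C /minsetP[Cd Cmin] CX].
exists C => //; rewrite /circuit (subset_trans CX XE) Cd /=.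
apply/forallP => D; apply/implyP => /properP[DC [x xC xD]].
by apply/negP => /Cmin/(_ DC) DE; rewrite DE xC in xD.
Qed.

Lemma supp_eliminate c d f : f \in E -> d f != 0 ->
  supp (fun x => c x - c f / d f * d x) \subset (supp c :|: supp d) :\ f.
Proof.
move=> fE df; apply/subsetP => x; rewrite !inE => /andP[xE].
have [->|xf] := eqVneq x f; first by rewrite divfK // subrr eqxx.
rewrite xE /=; have [->|//] := eqVneq (c x) 0.
by have [->|//] := eqVneq (d x) 0; rewrite mulr0 subrr eqxx.
Qed.

(** Induction on the support: if a circuit inside it misses [e], subtracting a multiple of its
    relation removes some [f] from the support and leaves the coefficient at [e] unchanged. *)
Lemma comb_circuit_at c e : comb v c E = 0 -> e \in supp c ->
  exists C, [/\ circuit M C, e \in C & C \subset supp c].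
Proof.
have [n] := ubnP #|supp c|; elim: n c => // n IH c cn c0 ec.
have sE c' : supp c' \subset E by apply/subsetP => x; rewrite inE => /andP[].
have [|C Cc Csub] := dependent_circuit (sE c).
  by apply: dependent_supp => //; apply/set0Pn; exists e.
have [eC|eC] := boolP (e \in C); first by exists C.
have [d [d0 dC]] := circuit_combP Cc.
have /set0Pn[f] : C != set0.
  by apply: contraTneq Cc => ->; rewrite /circuit /dependent cards0 ltn0 !andbF.
rewrite -dC inE => /andP[fE df].
have sub := supp_eliminate c fE df; set c' := (fun x => _) in sub.
have {}sub : supp c' \subset supp c :\ f.
  by apply: subset_trans sub _; rewrite dC (setUidPl Csub).
have [||| C' [? ? C'c]] := IH c'.
- rewrite -ltnS; apply: leq_trans cn; rewrite ltnS.
  apply: proper_card (sub_proper_trans sub (properD1 _)).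
  by apply: (subsetP Csub); rewrite -dC inE fE.
- by rewrite comb_subr c0 d0 scaler0 subr0.
- move: ec eC; rewrite -dC !inE => /andP[eE ce].
  by rewrite eE /= negbK => /eqP de; rewrite /c' de mulr0 subr0.
exists C'; split=> //; apply: subset_trans C'c _.
by apply: subset_trans sub _; apply: subD1set.
Qed.

Lemma circuit_elimination C1 C2 e f : circuit M C1 -> circuit M C2 ->
  e \in C1 -> e \notin C2 -> f \in C1 -> f \in C2 ->
  exists C, [/\ circuit M C, e \in C & C \subset (C1 :|: C2) :\ f].
Proof.
move=> /circuit_combP[c [c0 <-]] /circuit_combP[d [d0 <-]] ec ed _ fd.
have /andP[fE df] : (f \in E) && (d f != 0) by rewrite inE in fd.
have sub := supp_eliminate c fE df; set c' := (fun x => _) in sub.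
have [||C [? ? CS]] := @comb_circuit_at c' e.
- by rewrite comb_subr c0 d0 scaler0 subr0.
- move: ec ed; rewrite !inE => /andP[eE ce].
  by rewrite eE /= negbK => /eqP de; rewrite /c' de mulr0 subr0.
by exists C; split=> //; apply: subset_trans sub.
Qed.

(* Take the union of the two circuits minimal: eliminating [f] from either side
   gives circuits [C3] through [e] and [C4] through [g], and one of the pairs
   [C3, C2] and [C3, C4] meets and has a smaller union. *)
Lemma circuit_connect C1 C2 e g : circuit M C1 -> circuit M C2 ->
  e \in C1 -> g \in C2 -> C1 :&: C2 != set0 ->
  exists C, [/\ circuit M C, e \in C & g \in C].
Proof.
have [n] := ubnP #|C1 :|: C2|; elim: n C1 C2 => // n IH C1 C2 Cn cC1 cC2 eC1 gC2.
case/set0Pn => f; rewrite inE => /andP[fC1 fC2].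
have [eC2|eC2] := boolP (e \in C2); first by exists C2.
have [gC1|gC1] := boolP (g \in C1); first by exists C1.
(* By minimality, a circuit avoiding [f'] is not contained in a circuit through [f']. *)
have meets (X Y : {set T}) f' : circuit M X -> circuit M Y -> Y \subset (C1 :|: C2) :\ f' ->
    f' \in X -> X \subset C1 :|: C2 -> exists2 y, y \in Y & y \notin X.
  move=> cX cY YS fX XS; have [/subsetP YX|/subsetPn[y yY yX]] := boolP (Y \subset X).
    case/and3P: cX => _ _ /forallP/(_ Y); rewrite properE.
    have -> : Y \subset X by apply/subsetP.
    have -> : ~~ (X \subset Y).
      by apply/subsetPn; exists f' => //; apply/negP => /(subsetP YS); rewrite !inE eqxx.
    by case/and3P: cY => _ ->.
  by exists y.
have [C3 [cC3 eC3 C3S]] := circuit_elimination cC1 cC2 eC1 eC2 fC1 fC2.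
have [C4 [cC4 gC4 C4S]] := circuit_elimination cC2 cC1 gC2 gC1 fC2 fC1.
rewrite setUC in C4S.
have [y yC3 yC1] := meets C1 C3 f cC1 cC3 C3S fC1 (subsetUl _ _).
have [z zC4 zC2] := meets C2 C4 f cC2 cC4 C4S fC2 (subsetUr _ _).
have C3U : C3 \subset C1 :|: C2 by apply: subset_trans C3S (subD1set _ _).
have C4U : C4 \subset C1 :|: C2 by apply: subset_trans C4S (subD1set _ _).
have yC2 : y \in C2.
  by have := subsetP C3U y yC3; rewrite inE (negPf yC1).
have zC1 : z \in C1.
  by have := subsetP C4U z zC4; rewrite inE (negPf zC2) orbF.
have small (X Y : {set T}) a : X \subset C1 :|: C2 -> Y \subset C1 :|: C2 ->
    a \in C1 :|: C2 -> a \notin X :|: Y -> (#|X :|: Y| < n)%N.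
  move=> XU YU aU aN; apply: leq_trans (_ : #|X :|: Y| < #|C1 :|: C2|)%N _ => //.
  by apply: proper_card; apply/properP; split; [rewrite subUset XU | exists a].
have [zC3|zC3] := boolP (z \in C3); last first.
  apply: (IH C3 C2) => //; last by apply/set0Pn; exists y; rewrite inE yC3.
  apply: (small _ _ z) => //; first exact: subsetUr.
    by rewrite inE zC1.
  by rewrite inE negb_or zC3.
apply: (IH C3 C4) => //; last by apply/set0Pn; exists z; rewrite inE zC3.
apply: (small _ _ f) => //; first by rewrite inE fC1.
rewrite inE negb_or; apply/andP; split; apply/negP.
  by move=> /(subsetP C3S); rewrite !inE eqxx.
by move=> /(subsetP C4S); rewrite !inE eqxx.
Qed.

Lemma linkedxx e : linked M e e. Proof. by rewrite /linked eqxx. Qed.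

Lemma linked_sym e f : linked M e f = linked M f e.
Proof.
rewrite /linked eq_sym; congr (_ || _); apply: eq_existsb => C.
by congr (_ && _); rewrite andbC.
Qed.

Lemma circuit_linked C e f : circuit M C -> e \in C -> f \in C -> linked M e f.
Proof. by move=> cC eC fC; apply/orP; right; apply/existsP; exists C; rewrite cC eC. Qed.

Lemma linked_trans e f g : linked M e f -> linked M f g -> linked M e g.
Proof.
case/predU1P=> [->//|/existsP[C1 /and3P[cC1 eC1 fC1]]].
case/predU1P=> [<-|/existsP[C2 /and3P[cC2 fC2 gC2]]]; first exact: circuit_linked fC1.
have [|C [cC eC gC]] := circuit_connect cC1 cC2 eC1 gC2; last exact: circuit_linked gC.
by apply/set0Pn; exists f; rewrite inE fC1.
Qed.

Lemma component_linked e f : linked M e f -> component M e = component M f.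
Proof.
move=> ef; apply/setP => g; rewrite !inE; congr (_ && _); apply/idP/idP.
  by apply: linked_trans; rewrite linked_sym.
exact: linked_trans.
Qed.

Lemma component_fiber e : e \in E ->
  [set x in E | component M x == component M e] = component M e.
Proof.
move=> eE; apply/setP => x; rewrite [in LHS]inE [in RHS]inE; apply: andb_id2l => xE.
apply/eqP/idP => [xe|/component_linked->//].
have : x \in component M x by rewrite inE xE linkedxx.
by rewrite xe inE => /andP[].
Qed.

(** Induction on the support: a circuit relation lies within one component, so it splits trivially,
    and subtracting a multiple of it shrinks the support. *)
Lemma component_separates : separates (component M) v E.
Proof.
move=> c; have [n] := ubnP #|supp c|; elim: n c => // n IH c cn c0 k.
have [s0|[e ec]] := set_0Vmem (supp c).
  rewrite /comb big1 // => x; rewrite inE => /andP[xE _].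
  have : x \notin supp c by rewrite s0 inE.
  by rewrite inE xE negbK => /eqP->; rewrite scale0r.
have [C [cC eC Csub]] := comb_circuit_at c0 ec.
have [d [d0 dC]] := circuit_combP cC.
have /andP[eE de] : (e \in E) && (d e != 0) by rewrite -dC inE in eC.
have sub := supp_eliminate c eE de; set c' := (fun x => _) in sub.
have c'0 : comb v c' E = 0 by rewrite comb_subr c0 d0 scaler0 subr0.
have := IH c' _ c'0 k; rewrite comb_subr => c'k.
have dk : comb v d [set x in E | component M x == k] = 0.
  have [<-|ne] := eqVneq (component M e) k.
    rewrite comb_supp //; last by apply/subsetP => x; rewrite inE => /andP[].
    rewrite dC; apply/subsetP => x xC; rewrite inE.
    have /subsetP -> // : C \subset E by case/and3P: cC.
    by rewrite (component_linked (circuit_linked cC xC eC)) eqxx.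
  rewrite /comb big1 // => x; rewrite inE => /andP[xE /eqP xk].
  have : x \notin supp d.
    by rewrite dC; apply: contraNN ne => xC; rewrite -xk (component_linked (circuit_linked cC xC eC)).
  by rewrite inE xE negbK => /eqP->; rewrite scale0r.
move: c'k; rewrite dk scaler0 subr0; apply.
rewrite -ltnS; apply: leq_trans cn; rewrite ltnS.
rewrite dC (setUidPl Csub) in sub.
exact: proper_card (sub_proper_trans sub (properD1 ec)).
Qed.

Lemma component_connected e : e \in E -> connected (restrict M (component M e)).
Proof.
move=> eE; apply/forall_inP => x /=; rewrite !inE => /and3P[_ xE ex].
apply/forall_inP => y; rewrite !inE => /and3P[_ yE ey].
have : linked M x y by apply: linked_trans ey; rewrite linked_sym.
case/predU1P=> [->|/existsP[C /and3P[cC xC yC]]]; first by rewrite /linked eqxx.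
apply/orP; right; apply/existsP; exists C; rewrite xC yC !andbT.
case/and3P: cC (cC) => CE Cd Cmin cC; apply/and3P; split=> //=; rewrite subsetI CE.
apply/subsetP => z zC; rewrite inE (subsetP CE) //=.
exact: linked_trans ex (circuit_linked cC xC zC).
Qed.

End Circuits.

(** * From contraction-depth to shallow families *)

Section Shallow.
Variables (F : fieldType) (T : finType) (r : nat).
Implicit Types (v : T -> 'rV[F]_r) (M : matroid T).

Lemma represents_restrict v M X : represents v M -> represents v (restrict M X).
Proof. by move=> vM Y /=; rewrite subsetI => /andP[/vM]. Qed.

Lemma represents_contract v M e (h : 'cV_r) : represents v M -> e \in ground M ->
  v e != 0 -> (v e *m h) 0 0 = 1 ->
  represents (fun x => v x *m (1%:M - h *m v e)) (contract M e).
Proof.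
move=> vM eE ve0 veh X /=; rewrite subsetD1 => /andP[XE eX].
rewrite !vM ?sub1set // ?subUset ?sub1set ?eE // (rank_span_contract (h := h)) //.
by rewrite /rowspan big_set1 genmxE rank_rV ve0 subn1.
Qed.

(** The minimum in [cd_aux] starts from the remaining fuel plus one; by this bound the starting
    value never undercuts a genuine term. *)
Lemma cd_aux_le n M : (cd_aux n M <= n.+1)%N.
Proof.
elim: n M => //= n IH M; case: ifP => // _; case: ifP => // _; case: ifP => _.
  by rewrite ltnS; elim/big_ind: _ => // k m kn _; rewrite geq_min kn.
by apply/bigmax_leqP => e _; apply: leqW.
Qed.

Lemma dual_vector (u : 'rV[F]_r) : u != 0 -> exists h : 'cV[F]_r, (u *m h) 0 0 = 1.
Proof.
move=> /rV0Pn[j uj]; exists ((u 0 j)^-1 *: delta_mx j 0).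
by rewrite -scalemxAr mxE -colE mxE mulVf.
Qed.

Lemma represents_shallow n d v M : represents v M -> (#|ground M| <= n)%N ->
  (cd_aux n M <= d)%N -> shallow d v (ground M).
Proof.
(* A disconnected matroid and its components share the bound [d], so a component must come back
   rooted over level [d'], not merely shallow at level [d]. *)
suff : represents v M -> (#|ground M| <= n)%N ->
    (cd_aux n M <= d)%N -> shallow d v (ground M) /\
    (ground M != set0 -> connected M -> exists2 d', d = d'.+1 &
       rooted (shallow d') v (ground M)).
  by move=> H vM Mn cn; have [] := H vM Mn cn.
have shallow0 d' v' : shallow d' v' set0.
  case: d' => //= d'; exists (fun=> set0); split=> [c _ k|k].
    by rewrite /comb big1 // => x; rewrite !inE.
  by rewrite imset0 inE.
have rooted_shallow d' v' (A : {set T}) :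
    rooted (shallow d') v' A -> shallow d'.+1 v' A.
  move=> RA; exists (fun=> set0); split=> [c c0 k|k /imsetP[_ _ ->]].
    have [_|_] := eqVneq k set0.
      by rewrite -[RHS]c0; apply: eq_bigl => x; rewrite inE andbT.
    by rewrite /comb big1 // => x; rewrite inE andbF.
  suff -> : [set x in A | set0 == set0 :> {set T}] = A by [].
  by apply/setP => x; rewrite inE eqxx andbT.
elim: n d v M => [|n IH] d v M vM Mn.
  by move: Mn; rewrite leqn0 cards_eq0 => /eqP-> _; split=> //; rewrite eqxx.
rewrite /=; case: ifP => [|/negbT M0].
  by rewrite cards_eq0 => /eqP-> _; split=> //; rewrite eqxx.
case: ifP => [/cards1P[e Ee]|M1].
  case: d => // d _; suff R : rooted (shallow d) v (ground M).
    by split=> [|_ _]; [apply: rooted_shallow | exists d].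
  have [h veh] : exists h : 'cV[F]_r, v e *m (1%:M - h *m v e) = 0.
    have [ve|/dual_vector[h veh]] := eqVneq (v e) 0; first by exists 0; rewrite ve mul0mx.
    by exists h; rewrite mulmxBr mulmx1 mulmxA [_ *m h]mx11_scalar veh mul_scalar_mx scale1r subrr.
  by exists e, h; split; rewrite // Ee ?inE // setDv.
case: ifP => [cM|ncM].
  case: d => // d; rewrite ltnS -ltnS => min.
  suff R : rooted (shallow d) v (ground M).
    by split=> [|_ _]; [apply: rooted_shallow | exists d].
  have [e eE ce] : exists2 e, e \in ground M & (cd_aux n (contract M e) <= d)%N.
    case/bigminn_ltn: min => [nd|[e eE]]; last by rewrite ltnS => ed; exists e.
    move: M0; rewrite cards_eq0 => /set0Pn[e eE]; exists e => //.
    by move: nd; rewrite ltnS; apply: leq_trans (cd_aux_le _ _).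
  have ve0 : v e != 0.
    (* A second element [f] shares a circuit with [e]; its proper subset [[set e]] is independent,
       so [v e] is nonzero. *)
    have /set0Pn[f] : ground M :\ e != set0.
      apply: contraFneq M1 => E0; apply/cards1P; exists e.
      by rewrite -(setD1K eE) E0 setU0.
    rewrite !inE => /andP[fe fE].
    have /forall_inP/(_ e eE)/forall_inP/(_ f fE) := cM.
    rewrite /linked eq_sym (negPf fe) /= => /existsP[C /and3P[/and3P[_ _ /forallP Cmin] eC fC]].
    have := Cmin [set e]; rewrite properE sub1set eC /=.
    have -> : ~~ (C \subset [set e]).
      by apply/subsetPn; exists f; rewrite // inE.
    rewrite /dependent cards1 vM ?sub1set // /rowspan big_set1 genmxE rank_rV.
    by case: eqP.
  have [h veh] := dual_vector ve0.
  exists e, h; split=> //.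
    by rewrite mulmxBr mulmx1 mulmxA [_ *m h]mx11_scalar veh mul_scalar_mx scale1r subrr.
  have En : (#|ground (contract M e)| <= n)%N by move: Mn; rewrite (cardsD1 e) eE.
  by have [] := IH d _ _ (represents_contract vM eE ve0 veh) En ce.
move=> maxd; split; last by [].
have comp e : e \in ground M -> exists2 d', d = d'.+1 &
    rooted (shallow d') v (component M e).
  move=> eE; have Ec : ground (restrict M (component M e)) = component M e.
    by apply/setIidPr/subsetP => x; rewrite inE => /andP[].
  have ed : (cd_aux n (restrict M (component M e)) <= d)%N.
    by apply: leq_trans maxd; apply: leq_bigmax_cond.
  suff : exists2 d', d = d'.+1 &
      rooted (shallow d') v (ground (restrict M (component M e))) by rewrite Ec.
  have cn : (#|ground (restrict M (component M e))| <= n)%N.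
    rewrite Ec.
    rewrite -ltnS; apply: leq_trans Mn; apply: proper_card.
    rewrite properEneq; apply/andP; split; last first.
      by apply/subsetP => x; rewrite inE => /andP[].
    (* A component equal to the whole ground set would make [M] connected; hence it is smaller and
       the reduced fuel suffices. *)
    apply: contraFneq ncM => full.
    have := component_connected vM eE.
    rewrite full /connected /= setIid => /forall_inP H; apply/forall_inP => x xE.
    apply/forall_inP => y yE.
    have lx z : z \in ground M -> linked M e z by rewrite -{1}full inE => /andP[].
    by apply: (linked_trans vM) (lx y yE); rewrite linked_sym; apply: lx.
  have [_ H] := IH d v _ (represents_restrict (X := component M e) vM) cn ed.
  apply: H; last exact: (component_connected vM eE).
  by rewrite Ec; apply/set0Pn; exists e; rewrite inE eE linkedxx.
have [E0|[e eE]] := set_0Vmem (ground M); first by rewrite E0.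
have [d' dE _] := comp e eE; rewrite {}dE in comp *.
exists (component M); split; first exact: component_separates vM.
move=> k /imsetP[f fE ->]; rewrite (component_fiber vM fE).
by have [_ [<-]] := comp f fE.
Qed.

End Shallow.

Local Close Scope ring_scope.

(** * Invariance of contraction-depth *)

Section Isomorphism.
Variables (T T' : finType) (phi : T -> T').
Implicit Types (M : matroid T) (N : matroid T') (X C : {set T}).

Definition rank_iso M N := [/\ {in ground M &, injective phi},
  ground N = phi @: ground M &
  forall X, X \subset ground M -> rk N (phi @: X) = rk M X].

Lemma subset_imset_inv (A : {set T}) (Y : {set T'}) : Y \subset phi @: A ->
  exists2 X : {set T}, X \subset A & Y = phi @: X.
Proof.
move=> YA; exists [set x in A | phi x \in Y].
  by apply/subsetP => x; rewrite inE => /andP[].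
apply/setP => y; apply/idP/imsetP => [yY|[x]]; last by rewrite inE => /andP[_ +] ->.
by have /imsetP[x xA yE] := subsetP YA y yY; exists x; rewrite // inE xA -yE.
Qed.

Variables (M : matroid T) (N : matroid T').
Hypothesis MN : rank_iso M N.
Local Notation E := (ground M).

Lemma iso_mem_imset X x : X \subset E -> x \in E -> (phi x \in phi @: X) = (x \in X).
Proof.
have [phiI _ _] := MN; move=> XE xE; apply/imsetP/idP => [[y yX /phiI->//]|xX].
  exact: (subsetP XE).
by exists x.
Qed.

Lemma iso_dependent X : X \subset E -> dependent N (phi @: X) = dependent M X.
Proof.
have [phiI _ phiR] := MN; move=> XE; rewrite /dependent phiR // card_in_imset //.
by move=> x y /(subsetP XE) xE /(subsetP XE) yE; apply: phiI.
Qed.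

Lemma iso_subset (X Y : {set T}) : X \subset E -> Y \subset E ->
  (phi @: X \subset phi @: Y) = (X \subset Y).
Proof.
move=> XE YE; apply/idP/idP => [/subsetP XY|]; last exact: imsetS.
by apply/subsetP => x xX; rewrite -iso_mem_imset ?(subsetP XE) // XY // imset_f.
Qed.

Lemma iso_circuit C : C \subset E -> circuit N (phi @: C) = circuit M C.
Proof.
have [phiI phiE _] := MN; move=> CE.
rewrite /circuit phiE imsetS // CE iso_dependent //=; congr andb.
have subE (D : {set T}) : D \proper C -> D \subset E.
  by move=> DC; apply: subset_trans (proper_sub DC) CE.
apply/forallP/forallP => H D; apply/implyP => DC.
  have DE := subE D DC; have := H (phi @: D).
  by rewrite iso_dependent // properE !iso_subset // -properE DC.
have [X XC DX] := subset_imset_inv (proper_sub DC).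
have XE := subset_trans XC CE.
by rewrite DX iso_dependent //; apply: (implyP (H X)); move: DC; rewrite DX !properE !iso_subset.
Qed.

Lemma iso_linked : {in E &, forall x y, linked N (phi x) (phi y) = linked M x y}.
Proof.
have [phiI phiE _] := MN; move=> x y xE yE; rewrite /linked (inj_in_eq phiI) //.
congr orb; apply/existsP/existsP => -[C /and3P[cC xC yC]].
  have /andP[CE _] := cC; rewrite phiE in CE.
  have [X XE CX] := subset_imset_inv CE.
  move: xC yC cC; rewrite CX !iso_mem_imset // iso_circuit // => xX yX cX.
  by exists X; rewrite cX xX.
exists (phi @: C); have /andP[CE _] := cC.
by rewrite iso_circuit // !iso_mem_imset // cC xC.
Qed.

Lemma iso_connected : connected N = connected M.
Proof.
have [phiI phiE _] := MN; rewrite /connected phiE.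
apply/forall_inP/forall_inP => H x xE; apply/forall_inP => y yE.
  rewrite -iso_linked //.
  by have /forall_inP := H _ (imset_f phi xE); apply; apply: imset_f.
case/imsetP: xE yE => {}x xE -> /imsetP[{}y yE ->]; rewrite iso_linked //.
by have /forall_inP := H x xE; apply.
Qed.

Lemma iso_component x : x \in E -> component N (phi x) = phi @: component M x.
Proof.
have [phiI phiE _] := MN; move=> xE; apply/setP => y; rewrite inE phiE.
apply/andP/imsetP => [[/imsetP[z zE ->]]|[z]].
  by rewrite iso_linked // => xz; exists z; rewrite // inE zE.
by rewrite inE => /andP[zE xz] ->; rewrite imset_f // iso_linked.
Qed.

Lemma iso_restrict X : X \subset E -> rank_iso (restrict M X) (restrict N (phi @: X)).
Proof.
have [phiI phiE phiR] := MN; move=> XE; split=> /=.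
- by move=> x y; rewrite !inE => /andP[xE _] /andP[yE _]; apply: phiI.
- by rewrite phiE (setIidPr XE); apply/setIidPr/imsetS.
- by move=> Y; rewrite subsetI => /andP[/phiR].
Qed.

Lemma iso_contract e : e \in E -> rank_iso (contract M e) (contract N (phi e)).
Proof.
have [phiI phiE phiR] := MN; move=> eE; split=> /=.
- by move=> x y; rewrite !inE => /andP[_ xE] /andP[_ yE]; apply: phiI.
- rewrite phiE; apply/setP => y; rewrite !inE; apply/andP/imsetP.
    move=> [ye /imsetP[x xE yx]]; exists x; rewrite // !inE xE andbT.
    by apply: contraNneq ye => <-; rewrite yx.
  move=> [x]; rewrite !inE => /andP[xe xE] ->; rewrite imset_f //.
  by rewrite (inj_in_eq phiI).
- move=> X; rewrite subsetD1 => /andP[XE _].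
  by rewrite -imset_set1 -imsetU !phiR ?subUset ?sub1set ?eE.
Qed.

End Isomorphism.

Lemma cd_aux_iso (T T' : finType) (phi : T -> T') n (M : matroid T) (N : matroid T') :
  rank_iso phi M N -> cd_aux n N = cd_aux n M.
Proof.
elim: n M N => //= n IH M N MN; have [phiI phiE _] := MN.
rewrite phiE card_in_imset // (iso_connected MN).
do 2!case: ifP => // _; case: ifP => _.
  rewrite bigminn_imset; congr _.+1; apply: eq_bigr => e eE.
  by apply: IH; apply: iso_contract.
rewrite big_imset //=; apply: eq_bigr => e eE; rewrite (iso_component MN) //.
apply: IH; apply: iso_restrict => //.
by apply/subsetP => x; rewrite inE => /andP[].
Qed.

Lemma cd_iso (T T' : finType) (phi : T -> T') (M : matroid T) (N : matroid T') :
  rank_iso phi M N -> cd N = cd M.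
Proof.
move=> MN; have [phiI phiE _] := MN.
by rewrite /cd phiE card_in_imset //; apply: cd_aux_iso MN.
Qed.

(** * Critical matroids over a fixed field *)

Definition critical (T : finType) d (M : matroid T) := cd M = d /\
  forall S : {set T}, S \subset ground M -> S != set0 -> cd (delete M S) < d.

Lemma emb_rank_iso (F : fieldType) Q (x y : vfamily F Q) phi
    (M : matroid (carrier x)) (N : matroid (carrier y)) :
  emb_by phi -> ground M = dom x -> ground N = dom y ->
  represents (@vec _ _ x) M -> represents (@vec _ _ y) N ->
  rank_iso phi M (delete N (ground N :\: phi @: ground M)).
Proof.
move=> [phiI phiD phiR] Mx Ny xM yN.
have sub : phi @: ground M \subset ground N.
  by apply/subsetP => _ /imsetP[a aM ->]; rewrite Mx in aM; rewrite Ny; have [] := phiD a aM.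
split=> [||X XM] /=; first by rewrite Mx.
  by rewrite setDDr setDv set0U (setIidPr sub).
rewrite yN; last by apply: subset_trans sub; apply: imsetS.
rewrite xM // (rank_span_eq phiR) -?Mx //; congr (\rank _).
rewrite /rowspan big_imset //= => a b /(subsetP XM) aM /(subsetP XM) bM.
by apply: phiI; rewrite -Mx.
Qed.

(** Without a bound there is a sequence of critical matroids of strictly increasing size. An
    embedding between two of them exhibits the smaller as a deletion of the larger with the same
    depth, so nothing is deleted and the sizes contradict each other. *)
Lemma critical_bound (F : finFieldType) d : exists n, forall (T : finType) (M : matroid T),
  representable F M -> critical d M -> #|ground M| <= n.
Proof.
apply: contrapT => /forallNP H.
pose good (x : vfamily F unit) := exists M : matroid (carrier x),
  [/\ ground M = dom x, represents (@vec _ _ x) M & critical d M].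
have {H}/choice[f Hf] n : exists x, good x /\ n < #|dom x|.
  have /existsNP[T /existsNP[M]] := H n.
  move=> /not_implyP[[r [v vM]] /not_implyP[cM /negP]]; rewrite -ltnNge => nM.
  have /set0Pn[t _] : ground M != set0 by rewrite -card_gt0; apply: leq_ltn_trans nM.
  by exists (VFamily t v (ground M) (fun=> tt)); split=> //; exists M.
pose s := fix s i := if i is i'.+1 then f #|dom (s i')| else f 0.
have sG i : good (s i) by case: i => [|i]; apply: (Hf _).1.
have [|i [j [ij [phi xy]]]] := @wqo_shallow F d unit s.
  move=> i; have [M [<- vM [cM _]]] := sG i.
  by apply: (represents_shallow vM (leqnn _)); rewrite -cM.
have card_lt : #|dom (s i)| < #|dom (s j)|.
  apply: (@increasing_ltn (fun k => #|dom (s k)|)) ij => k /=.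
  by have [] := Hf #|dom (s k)|.
have [M [Mx vM [cM _]]] := sG i; have [N [Ny vN [cN minN]]] := sG j.
have iso := emb_rank_iso xy Mx Ny vM vN.
have := minN _ (subsetDl (ground N) (phi @: ground M)).
rewrite (cd_iso iso) cM ltnn => contra; suff : false by [].
apply: contra; rewrite setD_eq0; apply: contraL card_lt => sub; rewrite -leqNgt -Mx -Ny.
by apply: leq_trans (subset_leq_card sub) (leq_imset_card _ _).
Qed.

(** * Uniformity over fields of equal cardinality *)

Section FieldTables.
Local Open Scope ring_scope.

Lemma representable_map (F F' : fieldType) (f : {rmorphism F -> F'}) (T : finType)
  (M : matroid T) : representable F M -> representable F' M.
Proof.
move=> [r [v vM]]; exists r, (fun x => map_mx f (v x)) => X XE; rewrite vM //.
rewrite -(mxrank_map f) /rowspan; apply/eqmx_rank/eqmxP.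
elim/set_setU1_ind: X {XE} => [|x X xX IH]; first by rewrite !big_set0 map_mx0; apply: eqmx_refl.
rewrite !big_setU1 //=; apply: eqmx_trans (map_addsmx _ _ _) _.
by apply: adds_eqmx => //; apply: map_genmx.
Qed.

Definition table q := {ffun 'I_q * 'I_q -> 'I_q * 'I_q}.

(* Finitely many tables describe all fields with [q] elements, which makes the bound
   depend on the cardinality of the field only. *)
Definition tabulates q (t : table q) (F : finFieldType) :=
  exists g : F -> 'I_q, bijective g /\
    forall x y, t (g x, g y) = (g (x + y), g (x * y)).

Lemma tabulates_card q (F : finFieldType) : #|F| = q -> exists t : table q, tabulates t F.
Proof.
move=> <-; exists [ffun p => (enum_rank (enum_val p.1 + enum_val p.2),
                              enum_rank (enum_val p.1 * enum_val p.2))].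
exists enum_rank; split; first exact: enum_rank_bij.
by move=> x y; rewrite ffunE /= !enum_rankK.
Qed.

(** One labelling followed by the inverse of the other respects both operations; preservation of 0
    and 1 then follows by cancellation. *)
Lemma tabulates_morphism q (t : table q) (F F' : finFieldType) :
  tabulates t F -> tabulates t F' -> inhabited {rmorphism F -> F'}.
Proof.
move=> [g [g_bij tg]] [g' [[k g'K kK] tg']].
pose f x := k (g x).
have g'f x : g' (f x) = g x by rewrite /f kK.
have fDM x y : f (x + y) = f x + f y /\ f (x * y) = f x * f y.
  have := tg' (f x) (f y); rewrite !g'f tg => -[gD gM].
  by rewrite /f gD gM !g'K.
have fD x y : f (x + y) = f x + f y by have [] := fDM x y.
have fM x y : f (x * y) = f x * f y by have [] := fDM x y.
have f0 : f 0 = 0 by apply: (addrI (f 0)); rewrite -fD !addr0.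
have f1 : f 1 = 1.
  have f1n : f 1 != 0.
    rewrite -f0; apply/negP => /eqP/(congr1 g'); rewrite !g'f => /(bij_inj g_bij)/eqP.
    by rewrite oner_eq0.
  by apply: (mulfI f1n); rewrite -fM !mulr1.
have fB : {morph f : x y / x - y}.
  by move=> x y; apply/eqP; rewrite eq_sym subr_eq -fD subrK.
pose fA := GRing.isZmodMorphism.Build _ _ f fB.
pose fm := GRing.isMonoidMorphism.Build _ _ f (f1, fM).
by constructor; exact: (HB.pack f fA fm : {rmorphism F -> F'}).
Qed.

End FieldTables.

Theorem theorem4 :
  exists f : nat -> nat -> nat,
    forall (F : finFieldType) (T : finType) (M : matroid T) (d : nat),
      representable F M ->
      cd M = d ->
      (forall S : {set T}, S \subset ground M -> S != set0 ->
         cd (delete M S) < d) ->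
      #|ground M| <= f #|F| d.
Proof.
have /choice[f Hf] (qd : nat * nat) : exists n, forall F : finFieldType, #|F| = qd.1 ->
    forall (T : finType) (M : matroid T),
    representable F M -> critical qd.2 M -> #|ground M| <= n.
  case: qd => q d /=.
  have /choice[n Hn] (t : table q) : exists n, forall F : finFieldType, tabulates t F ->
      forall (T : finType) (M : matroid T),
      representable F M -> critical d M -> #|ground M| <= n.
    (* A table of no field gets the bound [0]. Otherwise one field [F0] supplies the bound, and
       representations over any field with the same table are carried to [F0]. *)
    have [[F0 tF0]|none] := pselect (exists F, tabulates t F); last first.
      by exists 0 => F tF; case: none; exists F.
    have [n Hn] := critical_bound F0 d; exists n => F tF T M FM cM.
    have [g] := tabulates_morphism tF tF0.
    by apply: Hn => //; apply: representable_map g _ _ FM.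
  exists (\max_t n t) => F /tabulates_card[t tF] T M FM cM.
  by apply: leq_trans (Hn t F tF T M FM cM) (leq_bigmax _).
exists (fun q d => f (q, d)) => F T M d FM cM minM.
by apply: (Hf (#|F|, d)) FM _.
Qed.
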